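(* Let $G$ be a finite, undirected, simple graph with at least one vertex and with maximum degree $\Delta$. Then, for any real $\lambda>0$, $$V_G(\lambda)\;\geq\; V_{K_{\Delta+1}}(\lambda)=\frac{\lambda}{(1+(\Delta+1)\lambda)^2},$$ with equality if and only if $G$ is a disjoint union of copies of $K_{\Delta+1}$.
   Context: All graphs are finite, undirected and simple, with at least one vertex. $K_m$ denotes the complete graph on $m$ vertices. For a graph $G$ on $n$ vertices, $\mathcal{I}(G)$ is the set of all independent sets of $G$ (including the empty set), and the independence polynomial (partition function of the hard-core model) is $P_G(\lambda)=\sum_{I\in\mathcal{I}(G)}\lambda^{|I|}$ for $\lambda>0$. The hard-core model on $G$ at fugacity $\lambda$ is the probability measure on $\mathcal{I}(G)$ given by $\Pr[I]=\lambda^{|I|}/P_G(\lambda)$. The free energy density is $F_G(\lambda)=\frac1n\log P_G(\lambda)$, the occupancy fraction is $E_G(\lambda)=\lambda\frac{\partial}{\partial\lambda}F_G(\lambda)$, and the variance fraction is $V_G(\lambda)=\lambda\frac{\partial}{\partial\lambda}E_G(\lambda)$. Equivalently, $nE_G(\lambda)=\mathbb{E}(|I|)$ and $nV_G(\lambda)=\operatorname{Var}(|I|)$, where $I$ is drawn from the hard-core model on $G$ at fugacity $\lambda$. *)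

(* Defs.v *)
From HB Require Import structures.
From mathcomp Require Import all_boot all_order all_algebra.
From mathcomp Require Import all_classical all_reals all_analysis.
Import Order.TTheory GRing.Theory Num.Theory.
Import numFieldNormedType.Exports.

Set Implicit Arguments.
Unset Strict Implicit.
Unset Printing Implicit Defensive.

Local Open Scope ring_scope.

Record sgraph := SGraph {
  vertex :> finType;
  adj : rel vertex;
  adj_sym : symmetric adj;
  adj_irr : irreflexive adj }.

Definition neighbors (G : sgraph) (v : G) : {set G} := [set u | adj v u].

Definition max_degree (G : sgraph) : nat := \max_(v : G) #|neighbors v|.

Definition independent (G : sgraph) (I : {set G}) : bool :=
  [forall u in I, forall v in I, ~~ adj u v].

Section CompleteGraph.
Variable m : nat.
Definition complete_adj : rel 'I_m := fun i j => i != j.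
Lemma complete_adj_sym : symmetric complete_adj.
Proof. by move=> i j; rewrite /complete_adj eq_sym. Qed.
Lemma complete_adj_irr : irreflexive complete_adj.
Proof. by move=> i; rewrite /complete_adj eqxx. Qed.
Definition complete_graph : sgraph := SGraph complete_adj_sym complete_adj_irr.
End CompleteGraph.

Section DisjointCopies.
Variables (k : nat) (G : sgraph).
Definition copies_adj : rel ('I_k * G)%type :=
  fun x y => (x.1 == y.1) && adj x.2 y.2.
Lemma copies_adj_sym : symmetric copies_adj.
Proof. by move=> x y; rewrite /copies_adj eq_sym adj_sym. Qed.
Lemma copies_adj_irr : irreflexive copies_adj.
Proof. by move=> x; rewrite /copies_adj adj_irr andbF. Qed.
Definition disjoint_copies : sgraph := SGraph copies_adj_sym copies_adj_irr.
End DisjointCopies.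

Definition isomorphic (G H : sgraph) : Prop :=
  exists2 f : G -> H, bijective f & forall u v, adj (f u) (f v) = adj u v.

Definition is_disjoint_union_of_copies (G H : sgraph) : Prop :=
  exists k : nat, isomorphic G (disjoint_copies k H).

Section HardCore.
Variables (R : realType) (G : sgraph).

Definition indep_poly (x : R) : R :=
  \sum_(I : {set G} | independent I) x ^+ #|I|.

(* ln and derive1 are total: the three functions below are only meaningful at
   x > 0, where indep_poly is positive, and for nonempty G. *)
Definition free_energy_density (x : R) : R := #|G|%:R^-1 * ln (indep_poly x).

Definition occupancy_fraction (x : R) : R := x * derive1 free_energy_density x.

Definition variance_fraction (x : R) : R := x * derive1 occupancy_fraction x.

End HardCore.

(* Main.v *)
(* Write X = |I|, d = Delta + 1, n = |G|, and let F be the number of vertices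
   lying in no closed neighbourhood of a vertex of I.  Counting pairs (I, v)
   with v in I gives E[X h(I)] = lambda E[sum of h(I + v) over free v].  For
   h = 1, X, F this yields E X = lambda E F, E X^2 = lambda (E[X F] + E F) and
   E[X F] >= lambda (E F^2 - d E F), as adding v to I destroys at most d free
   vertices.  Inserting these in Var(F + d X) >= 0 gives
   Var X >= lambda E F / (1 + d lambda), and F >= n - d X gives
   E F (1 + d lambda) >= n.  Equality forces F = n - d X on all independent
   sets; those of size one and two then show that the closed neighbourhoods
   have d elements and partition the vertices, hence are cliques K_d. *)
Require Import Defs.
From mathcomp Require Import all_boot all_order all_algebra.
From mathcomp Require Import all_classical all_reals all_analysis.
From mathcomp Require Import ring lra zify.
Import Order.TTheory GRing.Theory Num.Theory.
Import numFieldNormedType.Exports.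

Set Implicit Arguments.
Unset Strict Implicit.
Unset Printing Implicit Defensive.

Local Open Scope ring_scope.

(** * Closed neighbourhoods and the vertices left free by an independent set *)

Section FreeVertices.
Variable G : sgraph.
Implicit Types (u v : G) (I : {set G}).

Definition closed_nbhd v : {set G} := v |: neighbors v.

Definition free_vertices I : {set G} := ~: \bigcup_(u in I) closed_nbhd u.

Lemma in_closed_nbhd u v : (u \in closed_nbhd v) = (u == v) || adj v u.
Proof. by rewrite !inE. Qed.

Lemma closed_nbhd_sym u v : (u \in closed_nbhd v) = (v \in closed_nbhd u).
Proof. by rewrite !in_closed_nbhd eq_sym adj_sym. Qed.

Lemma closed_nbhd_refl v : v \in closed_nbhd v.
Proof. by rewrite in_closed_nbhd eqxx. Qed.

Lemma card_closed_nbhd v : #|closed_nbhd v| = #|neighbors v|.+1.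
Proof. by rewrite cardsU1 inE adj_irr. Qed.

Lemma independentP I :
  reflect {in I &, forall u v, ~~ adj u v} (independent I).
Proof.
apply: (iffP forall_inP) => [h u v uI vI | h u uI].
  by have /forall_inP := h u uI; apply.
by apply/forall_inP => v; apply: h.
Qed.

Lemma free_vertices_set0 : free_vertices finset.set0 = [set: G].
Proof. by rewrite /free_vertices big_set0 finset.setC0. Qed.

Lemma free_verticesU1 v I :
  free_vertices (v |: I) = free_vertices I :\: closed_nbhd v.
Proof.
by rewrite /free_vertices finset.bigcup_setU big_set1 finset.setCU finset.setDE finset.setIC.
Qed.

Lemma free_vertices1 v : free_vertices [set v] = ~: closed_nbhd v.
Proof. by rewrite /free_vertices big_set1. Qed.

Lemma free_verticesP v I :
  reflect {in I, forall u, v \notin closed_nbhd u} (v \in free_vertices I).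
Proof.
rewrite inE; apply: (iffP idP) => [/finset.bigcupP h u uI | h].
  by apply/negP => vu; apply: h; exists u.
by apply/finset.bigcupP => -[u /h/negP].
Qed.

(** Passing between [I] and [v |: I] by this equivalence is what re-indexes the sum over pairs in
    [hc_mean_card] and drives the induction on independent sets. *)
Lemma independentU1 v I :
  (v \notin I) && independent (v |: I) =
  independent I && (v \in free_vertices I).
Proof.
apply/andP/andP => -[].
  move=> vI /independentP h; split.
    by apply/independentP => a b aI bI; apply: h; rewrite !inE ?aI ?bI orbT.
  apply/free_verticesP => u uI; rewrite in_closed_nbhd negb_or.
  rewrite h ?inE ?eqxx ?uI ?orbT // andbT.
  by apply: contraNneq vI => ->.
move=> /independentP h /free_verticesP fv; split.
  by apply/negP => /fv; rewrite closed_nbhd_refl.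
have avI u : u \in I -> ~~ adj u v.
  by move=> /fv; rewrite in_closed_nbhd negb_or => /andP[].
apply/independentP => a b; rewrite !inE.
move=> /orP[/eqP->|aI] /orP[/eqP->|bI]; rewrite ?adj_irr ?avI //.
  by rewrite adj_sym avI.
exact: h.
Qed.

Lemma independent_set0 : independent (finset.set0 : {set G}).
Proof. by apply/independentP => u v; rewrite inE. Qed.

Lemma independent1 v : independent [set v].
Proof.
by apply/independentP => a b; rewrite !inE => /eqP-> /eqP->; rewrite adj_irr.
Qed.

Lemma card_free_vertices_ge (d : nat) I :
  (forall v, #|closed_nbhd v| <= d)%N ->
  (#|G| <= #|free_vertices I| + d * #|I|)%N.
Proof.
move=> hd; rewrite -(cardsC (\bigcup_(u in I) closed_nbhd u)) addnC leq_add2l.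
rewrite mulnC -sum_nat_const.
elim/big_ind2: _ => [|m A n B leA leB|u _]; rewrite ?cards0 ?hd //.
by apply: leq_trans (leq_of_leqif (leq_card_setU A B)) _; exact: leq_add.
Qed.

(** The equality case of [card_free_vertices_ge]. For nonempty [G] and positive [d] it characterises
    the disjoint unions of copies of K_d. *)
Definition free_card_affine (d : nat) : Prop :=
  forall I, independent I -> (#|free_vertices I| + d * #|I| = #|G|)%N.

Lemma free_card_affine_closed_nbhd (d : nat) : free_card_affine d ->
  (forall v, #|closed_nbhd v| = d) /\
  (forall u v, u \in closed_nbhd v -> closed_nbhd u = closed_nbhd v).
Proof.
move=> tight.
have card_nbhd v : #|closed_nbhd v| = d.
  have := tight _ (independent1 v); have := cardsC (closed_nbhd v).
  by rewrite free_vertices1 cards1 muln1 => <-; rewrite addnC => /addIn.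
split=> // u v uv.
(* Vertices whose closed neighbourhoods meet are equal or adjacent: otherwise they form an
   independent pair that covers fewer than 2d vertices, against [tight]. *)
have common a b w : w \in closed_nbhd a -> w \in closed_nbhd b ->
    b \in closed_nbhd a.
  move=> wa wb; apply/negPn/negP => ba.
  have /andP[bNa ind] : (b \notin [set a]) && independent (b |: [set a]).
    by rewrite independentU1 independent1 free_vertices1 inE.
  have := tight _ ind.
  rewrite free_verticesU1 free_vertices1 finset.setDE -finset.setCU cardsU1 bNa cards1.
  have := cardsC (closed_nbhd a :|: closed_nbhd b).
  have := cardsUI (closed_nbhd a) (closed_nbhd b).
  have : (0 < #|closed_nbhd a :&: closed_nbhd b|)%N.
    by apply/card_gt0P; exists w; rewrite inE wa.
  by rewrite !card_nbhd; lia.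
(* Equal cardinalities reduce the claim to one inclusion; there [u] is the vertex common to the
   neighbourhoods of [v] and [w]. *)
apply/eqP; rewrite eqEcard !card_nbhd leqnn andbT; apply/fintype.subsetP => w wu.
by apply: (common v w u) => //; rewrite closed_nbhd_sym.
Qed.

(** By induction on the size of [I]: the neighbourhoods are classes of a partition, so the whole
    class of [v] is free for [I :\ v], and adding [v] back removes exactly [d] free vertices. *)
Lemma closed_nbhd_free_card_affine (d : nat) :
  (forall v, #|closed_nbhd v| = d) ->
  (forall u v, u \in closed_nbhd v -> closed_nbhd u = closed_nbhd v) ->
  free_card_affine d.
Proof.
move=> card_nbhd nbhd_eq I.
have [m] := ubnP #|I|; elim: m I => // m IH I.
have [->|[v vI]] := set_0Vmem I.
  by rewrite free_vertices_set0 cards0 muln0 addn0 cardsT.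
rewrite (cardsD1 v) vI ltnS => ltI indI.
have : (v \notin I :\ v) && independent (v |: (I :\ v)).
  by rewrite finset.setD1K // indI !inE eqxx.
rewrite independentU1 => /andP[indJ /free_verticesP fv].
have nbhd_free : closed_nbhd v \subset free_vertices (I :\ v).
  apply/fintype.subsetP => w wv; apply/free_verticesP => u uJ; apply/negP => wu.
  by have := fv u uJ; rewrite -(nbhd_eq _ _ wu) (nbhd_eq _ _ wv) closed_nbhd_refl.
have := IH _ ltI indJ; rewrite -[in free_vertices I](finset.setD1K vI) free_verticesU1.
have := subset_leq_card nbhd_free.
by rewrite [#|_ :\: closed_nbhd v|]cardsD (finset.setIidPr nbhd_free) card_nbhd; nia.
Qed.

End FreeVertices.

(** * Disjoint unions of cliques and the affine count of free vertices *)

Section CliqueUnions.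

Lemma disjoint_copies_complete_free_card_affine (d : nat) (G : sgraph) :
  is_disjoint_union_of_copies G (complete_graph d) -> free_card_affine G d.
Proof.
case=> k [f [g fK gK] fadj].
(* The closed neighbourhood of a vertex is the copy that contains it. *)
have nbhdE (v : G) : closed_nbhd v = [set u | (f u).1 == (f v).1].
  apply/setP => u; rewrite in_closed_nbhd inE -fadj /= /copies_adj /= /complete_adj.
  rewrite -(inj_eq (can_inj fK)) -pair_eqE /pair_eq /=.
  by rewrite [(f v).1 == _]eq_sym [(f v).2 == _]eq_sym; do 2 case: eqP.
apply: closed_nbhd_free_card_affine => [v|u v]; last first.
  by rewrite !nbhdE inE => /eqP->.
rewrite -(card_imset _ (can_inj fK)).
have -> : f @: closed_nbhd v = finset.setX [set (f v).1] [set: 'I_d] :> {set 'I_k * 'I_d}.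
  apply/setP => p; rewrite !inE andbT nbhdE.
  apply/imsetP/eqP => [[u]|pv]; first by rewrite inE => /eqP<- ->.
  by exists (g p); rewrite ?inE gK // pv.
by rewrite cardsX cards1 mul1n cardsT card_ord.
Qed.

Lemma complete_graph_disjoint_copies (d : nat) :
  is_disjoint_union_of_copies (complete_graph d) (complete_graph d).
Proof.
exists 1%N; exists (fun i => (ord0, i)) => //.
by exists snd => // -[i j]; rewrite (ord1 i).
Qed.

Lemma free_card_affine_disjoint_copies (d : nat) (G : sgraph) :
  (0 < #|G|)%N -> free_card_affine G d.+1 ->
  is_disjoint_union_of_copies G (complete_graph d.+1).
Proof.
move=> /card_gt0P[x0 _] /free_card_affine_closed_nbhd[card_nbhd nbhd_eq].
pose P := [set closed_nbhd v | v : G].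
have inP v : closed_nbhd v \in P by exact: imset_f.
exists #|P|.
(* A vertex goes to its class together with its rank in the enumeration of that class. The vertex
   [x0] serves as default for [enum_rank_in] and [nth], and [inord] calls for the successor
   [d.+1]. *)
pose f (v : G) : disjoint_copies #|P| (complete_graph d.+1) :=
  (enum_rank_in (inP x0) (closed_nbhd v), inord (index v (enum (closed_nbhd v)))).
pose g (p : disjoint_copies #|P| (complete_graph d.+1)) : G :=
  nth x0 (enum (enum_val p.1)) p.2.
have fK : cancel f g.
  move=> v; rewrite /f /g /= enum_rankK_in // inordK; last first.
    by rewrite -(card_nbhd v) cardE index_mem mem_enum closed_nbhd_refl.
  by rewrite nth_index // mem_enum closed_nbhd_refl.
have gK : cancel g f.
  move=> [i j]; rewrite /f /g /=; have /imsetP[v _ iE] := enum_valP i.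
  have size_i : size (enum (enum_val i)) = d.+1 by rewrite iE -cardE card_nbhd.
  set w := nth _ _ _.
  have wi : w \in enum_val i by rewrite -mem_enum mem_nth // size_i ltn_ord.
  have nbhd_w : closed_nbhd w = enum_val i by rewrite iE; apply: nbhd_eq; rewrite -iE.
  congr pair; first by rewrite nbhd_w enum_valK_in.
  by rewrite nbhd_w index_uniq ?enum_uniq ?size_i ?ltn_ord ?inord_val.
exists f; first by exists g.
move=> u v; have nbhd_uv : ((f u).1 == (f v).1) = (v \in closed_nbhd u).
  rewrite /f /=; apply/eqP/idP => [/(congr1 enum_val)|vu].
    by rewrite !enum_rankK_in // => ->; exact: closed_nbhd_refl.
  by rewrite (nbhd_eq _ _ vu).
(* Within one class adjacency means distinctness, which by injectivity of [f] means different second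
   coordinates. *)
have : (f u == f v) = (u == v) by rewrite (inj_eq (can_inj fK)).
rewrite -pair_eqE /pair_eq nbhd_uv in_closed_nbhd.
rewrite /= /copies_adj /= /complete_adj nbhd_uv in_closed_nbhd.
rewrite [v == u]eq_sym; case: (eqVneq u v) => [->|_] /=.
  by rewrite adj_irr => ->.
by case: (adj u v) => //= ->.
Qed.

End CliqueUnions.

(** * Hard-core expectations and the derivatives of the free energy *)

Section Moments.
Variables (R : realType) (G : sgraph).
Implicit Types (x : R) (g h : {set G} -> R).

(** The unnormalised expectation, kept apart from [hc_mean] because it is polynomial in [x] and so
    easy to differentiate. *)
Definition hc_sum x g : R := \sum_(I : {set G} | independent I) x ^+ #|I| * g I.

Definition hc_mean x g : R := hc_sum x g / indep_poly G x.

Lemma indep_polyE x : indep_poly G x = hc_sum x (fun=> 1).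
Proof. by apply: eq_bigr => I _; rewrite mulr1. Qed.

Lemma indep_poly_gt0 x : 0 < x -> 0 < indep_poly G x.
Proof.
move=> x0; rewrite /indep_poly (bigD1 finset.set0) ?independent_set0 //= cards0 expr0.
by apply: ltr_wpDr => //; apply: sumr_ge0 => I _; rewrite exprn_ge0 // ltW.
Qed.

Lemma hc_meanD x g h : hc_mean x (fun I => g I + h I) = hc_mean x g + hc_mean x h.
Proof.
rewrite /hc_mean -mulrDl /hc_sum -big_split /=; congr (_ / _).
by apply: eq_bigr => I _; rewrite mulrDr.
Qed.

Lemma hc_meanZ x (a : R) g : hc_mean x (fun I => a * g I) = a * hc_mean x g.
Proof.
rewrite /hc_mean mulrA /hc_sum [a * _]mulr_sumr; congr (_ / _).
by apply: eq_bigr => I _; rewrite mulrCA.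
Qed.

Lemma hc_mean_cst x (a : R) : 0 < x -> hc_mean x (fun=> a) = a.
Proof.
move=> /indep_poly_gt0 P0.
have -> : hc_mean x (fun=> a) = hc_mean x (fun=> a * 1) by rewrite mulr1.
by rewrite hc_meanZ /hc_mean -indep_polyE divff ?mulr1 // gt_eqF.
Qed.

Lemma eq_hc_mean x g h :
  (forall I, independent I -> g I = h I) -> hc_mean x g = hc_mean x h.
Proof.
by move=> gh; congr (_ / _); apply: eq_bigr => I /gh->.
Qed.

Lemma hc_mean_ge0 x g : 0 < x -> (forall I, independent I -> 0 <= g I) ->
  0 <= hc_mean x g.
Proof.
move=> x0 g0; apply: divr_ge0; last exact/ltW/indep_poly_gt0.
by apply: sumr_ge0 => I indI; rewrite mulr_ge0 ?g0 ?exprn_ge0 // ltW.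
Qed.

(** Every independent set has positive weight, so equality between means becomes equality on each
    independent set. *)
Lemma hc_mean_eq0 x g : 0 < x -> (forall I, independent I -> 0 <= g I) ->
  hc_mean x g = 0 -> forall I, independent I -> g I = 0.
Proof.
move=> x0 g0 /eqP; rewrite mulf_eq0 invr_eq0 [X in _ || X]gt_eqF ?indep_poly_gt0 //.
rewrite orbF => /eqP s0 I indI.
have term0 : x ^+ #|I| * g I = 0.
  move: I indI; apply: psumr_eq0P s0 => J indJ.
  by rewrite mulr_ge0 ?g0 ?exprn_ge0 // ltW.
by move/eqP: term0; rewrite mulf_eq0 expf_eq0 [x == 0]gt_eqF // andbF => /eqP.
Qed.

(* Counts the pairs (I, v) with v in I through J = I \ v, for which v is free. *)
Lemma hc_mean_card x h :
  hc_mean x (fun I => #|I|%:R * h I) =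
  x * hc_mean x (fun I => \sum_(v in free_vertices I) h (v |: I)).
Proof.
rewrite /hc_mean mulrA; congr (_ / _); rewrite /hc_sum mulr_sumr.
under eq_bigr => I _ do rewrite mulr_natl -sumr_const mulr_sumr.
under [RHS]eq_bigr => I _ do rewrite !mulr_sumr.
rewrite (exchange_big_dep predT) //= [RHS](exchange_big_dep predT) //=.
apply: eq_bigr => v _.
rewrite (reindex_onto (fun I => v |: I) (fun I => I :\ v)) /=; last first.
  by move=> I /andP[_ vI]; rewrite finset.setD1K.
apply: eq_big => [I|I].
  rewrite -independentU1 setU11 andbT andbC; congr (_ && _).
  (* The guard [(v |: I) :\ v == I] left by the re-indexing amounts to [v \notin I]. *)
  apply/eqP/idP => [<-|]; [by rewrite !inE eqxx | exact: setU1K].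
move=> /andP[_ /eqP vI]; rewrite cardsU1 -[in v \notin I]vI !inE eqxx /=.
by rewrite add1n exprS mulrA.
Qed.

(** Writing k x^(k-1) as x^-1 (k x^k), for nonzero [x], makes the derivative a weighted sum of the
    same kind. *)
Lemma is_derive_hc_sum x g : x != 0 ->
  is_derive x 1 (fun y => hc_sum y g) (x^-1 * hc_sum x (fun I => #|I|%:R * g I)).
Proof.
move=> x0; pose p : {poly R} := \sum_(I : {set G} | independent I) g I *: 'X^#|I|.
have -> : (fun y => hc_sum y g) = horner p.
  apply/funext => y; rewrite /p horner_sum; apply: eq_bigr => I _.
  by rewrite hornerZ hornerXn mulrC.
apply: is_derive_eq; rewrite /p raddf_sum horner_sum /hc_sum mulr_sumr.
apply: eq_bigr => I _; rewrite /= derivZ derivXn hornerZ hornerMn hornerXn.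
case: #|I| => [|k] /=; first by rewrite mulr0n mul0r !mulr0.
by rewrite exprS -mulr_natl; field.
Qed.

Lemma is_derive_indep_poly x : x != 0 ->
  is_derive x 1 (indep_poly G) (x^-1 * hc_sum x (fun I => #|I|%:R)).
Proof.
move=> x0.
have -> : indep_poly G = fun y => hc_sum y (fun=> 1).
  by apply/funext => y; rewrite indep_polyE.
by apply: is_derive_eq (is_derive_hc_sum _ x0) _; under eq_fun do rewrite mulr1.
Qed.

Lemma occupancy_fractionE x : 0 < x ->
  occupancy_fraction G x = #|G|%:R^-1 * hc_mean x (fun I => #|I|%:R).
Proof.
move=> x0; have P0 := indep_poly_gt0 x0.
have dP : is_derive x 1 (indep_poly G) _ := is_derive_indep_poly (lt0r_neq0 x0).
have dlnP := is_derive1_comp (is_derive1_ln P0) dP.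
rewrite /occupancy_fraction derive1E.
have -> : free_energy_density G = #|G|%:R^-1 *: (@ln R \o indep_poly G).
  by apply/funext.
rewrite derive_val /hc_mean.
have scaleE (a b : R) : a *: (b : R^o) = a * b by [].
by rewrite scaleE; move: (#|G|%:R^-1) => c; field; rewrite !gt_eqF.
Qed.

(** A closed form of the occupancy fraction holds only at positive fugacity; this suffices because a
    derivative depends only on values near [x]. *)
Lemma variance_fraction_is_derive x (phi : R -> R) (dphi : R) : 0 < x ->
  (forall y, 0 < y -> occupancy_fraction G y = phi y) ->
  is_derive x 1 phi dphi -> variance_fraction G x = x * dphi.
Proof.
move=> x0 phiE dphiE; rewrite /variance_fraction derive1E.
suff -> : 'D_1 (occupancy_fraction G) x = 'D_1 phi x by rewrite derive_val.
apply: near_eq_derive; near=> y; apply: phiE; near: y.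
exact: lt_nbhsr.
Unshelve. all: by end_near. Qed.

Lemma variance_fractionE x : 0 < x ->
  variance_fraction G x = #|G|%:R^-1 *
    (hc_mean x (fun I => #|I|%:R ^+ 2) - hc_mean x (fun I => #|I|%:R) ^+ 2).
Proof.
move=> x0; have P0 := indep_poly_gt0 x0; have xN0 : x != 0 by rewrite gt_eqF.
have dP : is_derive x 1 (indep_poly G) _ := is_derive_indep_poly xN0.
have dA := is_derive_hc_sum (fun I => #|I|%:R) xN0.
have dV := is_deriveV (lt0r_neq0 P0) dP.
have dM := is_deriveM dA dV.
have dZ := is_deriveZ #|G|%:R^-1 dM.
rewrite (variance_fraction_is_derive x0 occupancy_fractionE dZ) /hc_mean.
have scaleE (a b : R) : a *: (b : R^o) = a * b by [].
rewrite !scaleE; move: (#|G|%:R^-1) => c.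
under [in hc_sum x (fun I => _ ^+ _)]eq_fun do rewrite expr2.
by field; rewrite !gt_eqF.
Qed.

End Moments.

(** * Moment inequalities when closed neighbourhoods have at most [d] elements *)

Section Bounds.
Variables (R : realType) (G : sgraph) (d : nat) (x : R).
Hypothesis x_gt0 : 0 < x.

Let mean_free := hc_mean x (fun I : {set G} => #|free_vertices I|%:R).

Lemma hc_mean_card_free : hc_mean x (fun I : {set G} => #|I|%:R) = x * mean_free.
Proof.
have := @hc_mean_card R G x (fun=> 1).
under [in LHS](@eq_hc_mean R G) => I _ do rewrite mulr1.
by move=> ->; congr (_ * _); apply: eq_hc_mean => I _; rewrite sumr_const.
Qed.

Lemma hc_mean_card_sqr :
  hc_mean x (fun I : {set G} => #|I|%:R ^+ 2) =
  x * (hc_mean x (fun I : {set G} => #|I|%:R * #|free_vertices I|%:R) + mean_free).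
Proof.
have -> : hc_mean x (fun I : {set G} => #|I|%:R ^+ 2) =
          hc_mean x (fun I : {set G} => #|I|%:R * #|I|%:R).
  by apply: eq_hc_mean => I _; rewrite expr2.
rewrite hc_mean_card -hc_meanD; congr (_ * _); apply: eq_hc_mean => I indI.
rewrite (eq_bigr (fun=> #|I|.+1%:R)) => [|v vI]; last first.
  have : (v \notin I) && independent (v |: I) by rewrite independentU1 indI.
  by case/andP => vNI _; rewrite cardsU1 vNI.
by rewrite sumr_const -[_ *+ #|free_vertices I|]mulr_natr -natr1 mulrDl mul1r.
Qed.

Hypothesis card_nbhd : forall v : G, (#|closed_nbhd v| <= d)%N.

Lemma hc_mean_card_mul_free_ge :
  x * (hc_mean x (fun I : {set G} => #|free_vertices I|%:R ^+ 2) - d%:R * mean_free)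
  <= hc_mean x (fun I : {set G} => #|I|%:R * #|free_vertices I|%:R).
Proof.
rewrite hc_mean_card ler_pM2l //.
(* The difference is a single mean of a nonnegative function: each of the [F] free vertices, once
   added, leaves at least F - d free ones. The factor [-1] lets [hc_meanZ] apply. *)
have : 0 <= hc_mean x (fun I : {set G} =>
    \sum_(v in free_vertices I) #|free_vertices (v |: I)|%:R
    + (-1 * #|free_vertices I|%:R ^+ 2 + d%:R * #|free_vertices I|%:R)).
  apply: hc_mean_ge0 => // I _; set F := #|free_vertices I|.
  have : \sum_(v in free_vertices I) (F%:R - d%:R) <=
      \sum_(v in free_vertices I) #|free_vertices (v |: I)|%:R :> R.
    apply: ler_sum => v _; rewrite lerBlDr -natrD ler_nat free_verticesU1 /F.
    rewrite -(cardsID (closed_nbhd v) (free_vertices I)) addnC leq_add2l.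
    exact: leq_trans (subset_leq_card (finset.subsetIr _ _)) (card_nbhd v).
  rewrite sumr_const -mulr_natr -/F; nra.
by rewrite !hc_meanD !hc_meanZ -/mean_free; lra.
Qed.

Lemma card_le_mean_free : #|G|%:R <= mean_free * (1 + d%:R * x).
Proof.
have : 0 <= hc_mean x (fun I : {set G} =>
    #|free_vertices I|%:R + (d%:R * #|I|%:R + - #|G|%:R)).
  apply: hc_mean_ge0 => // I _; rewrite addrA subr_ge0 -natrM -natrD ler_nat.
  exact: card_free_vertices_ge.
rewrite !hc_meanD hc_meanZ hc_mean_cst // hc_mean_card_free -/mean_free.
by lra.
Qed.

(** The slack in [card_free_vertices_ge] is nonnegative with mean zero, hence zero on every
    independent set. *)
Lemma free_card_affine_of_mean :
  mean_free * (1 + d%:R * x) = #|G|%:R -> free_card_affine G d.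
Proof.
move=> mE I indI.
suff /eqP : #|free_vertices I|%:R + (d%:R * #|I|%:R + - #|G|%:R) = 0 :> R.
  by rewrite addrA subr_eq0 -natrM -natrD eqr_nat => /eqP.
move: I indI; apply: (hc_mean_eq0 x_gt0) => [I _|].
  by rewrite addrA subr_ge0 -natrM -natrD ler_nat; exact: card_free_vertices_ge.
rewrite !hc_meanD hc_meanZ hc_mean_cst // hc_mean_card_free -/mean_free -mE.
by ring.
Qed.

(* Expands Var(|F(I)| + d |I|) >= 0; that quantity is constant on unions of
   copies of K_d, so nothing is lost there. *)
Lemma variance_fraction_ge_mean_free :
  #|G|%:R^-1 * (x * mean_free / (1 + d%:R * x)) <= variance_fraction G x.
Proof.
set t := d%:R : R.
have den0 : 0 < 1 + t * x by rewrite ltr_wpDr // mulr_ge0 // ltW.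
rewrite variance_fractionE // hc_mean_card_free -/mean_free.
apply: ler_wpM2l; first by rewrite invr_ge0.
have sqr := hc_mean_card_sqr; have cross := hc_mean_card_mul_free_ge.
set S := hc_mean x _ in sqr *; set C := hc_mean x _ in sqr cross.
rewrite -/t in cross; set Q := hc_mean x _ in cross.
(* This is the mean of F + t X, since E X = x E F. *)
set a := mean_free * (1 + t * x).
have var_ge0 : 0 <= hc_mean x (fun I : {set G} =>
    (#|free_vertices I|%:R + t * #|I|%:R - a) ^+ 2).
  by apply: hc_mean_ge0 => // I _; exact: sqr_ge0.
rewrite [hc_mean x _](_ : _ = hc_mean x (fun I : {set G} => #|free_vertices I|%:R ^+ 2 +
    (2 * t * (#|I|%:R * #|free_vertices I|%:R) + (t ^+ 2 * #|I|%:R ^+ 2 +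
    (- (2 * a) * #|free_vertices I|%:R + (- (2 * a * t) * #|I|%:R + a ^+ 2))))))
  in var_ge0; last by apply: eq_hc_mean => I _; ring.
rewrite !hc_meanD !hc_meanZ hc_mean_cst // hc_mean_card_free -/mean_free in var_ge0.
rewrite -/S -/C -/Q in var_ge0.
rewrite ler_pdivrMr // -(ler_pM2r den0) -subr_ge0.
(* Once cleared of denominators, the gap is x^2 times the variance of F + t X plus x times the slack
   in [cross]; the second moment [Q] cancels. *)
have -> : (S - (x * mean_free) ^+ 2) * (1 + t * x) * (1 + t * x)
          - x * mean_free * (1 + t * x) =
    x ^+ 2 * (Q + (2 * t * C + (t ^+ 2 * S + (- (2 * a) * mean_free +
      (- (2 * a * t) * (x * mean_free) + a ^+ 2)))))
    + x * (C - x * (Q - t * mean_free)).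
  by rewrite sqr /a; ring.
by rewrite addr_ge0 // mulr_ge0 ?exprn_ge0 ?subr_ge0 // ltW.
Qed.

End Bounds.

(** * Exact variance for clique unions, and the conclusion *)

Lemma free_card_affine_variance (R : realType) (G : sgraph) (d : nat) (x : R) :
  (0 < #|G|)%N -> free_card_affine G d -> 0 < x ->
  variance_fraction G x = x / (1 + d%:R * x) ^+ 2.
Proof.
move=> G0 tight x0.
have den0 (y : R) : 0 < y -> 1 + d%:R * y != 0 :> R.
  by move=> y0; rewrite gt_eqF // ltr_wpDr // mulr_ge0 // ltW.
have occ (y : R) : 0 < y -> occupancy_fraction G y = y * (1 + d%:R * y)^-1.
  move=> y0; rewrite occupancy_fractionE //.
  have := hc_mean_card_free G y.
  (* Affinity turns E X = y E F into the linear equation E X = y (n - d E X), which determines E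
     X. *)
  have -> : hc_mean y (fun I : {set G} => #|free_vertices I|%:R) =
            #|G|%:R + - d%:R * hc_mean y (fun I : {set G} => #|I|%:R).
    rewrite -hc_meanZ -[#|G|%:R](@hc_mean_cst R G y) // -hc_meanD.
    apply: eq_hc_mean => I indI; rewrite -(tight I indI) natrD natrM; ring.
  move=> mE.
  have -> : hc_mean y (fun I : {set G} => #|I|%:R) = #|G|%:R * (y / (1 + d%:R * y)).
    apply: (mulIf (den0 _ y0)); rewrite mulrA divfK ?den0 //.
    by rewrite mulrDr mulr1 {1}mE; ring.
  by rewrite mulKf // pnatr_eq0 -lt0n.
have dden : is_derive x 1 (fun y : R => 1 + d%:R * y) (d%:R).
  apply: is_derive_eq (is_deriveD (is_derive_cst (1 : R) x 1)
    (is_deriveZ d%:R (is_derive_id x 1))) _.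
  by rewrite add0r; exact: mulr1.
have dV := @is_deriveV R (fun y => 1 + d%:R * y) x _ _ (den0 _ x0) dden.
have dM := is_deriveM (is_derive_id x 1) dV.
rewrite (variance_fraction_is_derive x0 occ dM).
have scaleE (a b : R) : a *: (b : R^o) = a * b by [].
by rewrite !scaleE; field; exact: den0.
Qed.

Theorem theorem1p3 (R : realType) (G : sgraph) (G_gt0 : (0 < #|G|)%N)
    (Delta : nat) (Delta_max : max_degree G = Delta)
    (lambda : R) (lambda_gt0 : 0 < lambda) :
  [/\ variance_fraction (complete_graph Delta.+1) lambda
        <= variance_fraction G lambda,
      variance_fraction (complete_graph Delta.+1) lambda
        = lambda / (1 + Delta.+1%:R * lambda) ^+ 2
    & variance_fraction G lambda
        = variance_fraction (complete_graph Delta.+1) lambda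
      <-> is_disjoint_union_of_copies G (complete_graph Delta.+1)].
Proof.
have card_nbhd (v : G) : (#|closed_nbhd v| <= Delta.+1)%N.
  by rewrite card_closed_nbhd ltnS -Delta_max; exact: leq_bigmax.
have KE : variance_fraction (complete_graph Delta.+1) lambda
          = lambda / (1 + Delta.+1%:R * lambda) ^+ 2.
  apply: free_card_affine_variance => //; first by rewrite card_ord.
  exact/disjoint_copies_complete_free_card_affine/complete_graph_disjoint_copies.
have mge := card_le_mean_free lambda_gt0 card_nbhd.
have vge := variance_fraction_ge_mean_free lambda_gt0 card_nbhd.
set m := hc_mean _ _ in mge vge.
have den0 : 0 < 1 + Delta.+1%:R * lambda by rewrite ltr_wpDr // mulr_ge0 // ltW.
have n0 : 0 < #|G|%:R :> R by rewrite ltr0n.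
(* The lower bound factors as the value for the clique times the ratio m (1 + d lambda) / n with d =
   Delta + 1, and [mge] says that this ratio is at least 1. *)
have vE : #|G|%:R^-1 * (lambda * m / (1 + Delta.+1%:R * lambda)) =
    lambda / (1 + Delta.+1%:R * lambda) ^+ 2 *
    (#|G|%:R^-1 * (m * (1 + Delta.+1%:R * lambda))).
  by move: (Delta.+1%:R) den0 => t den0; field; rewrite !gt_eqF.
have c0 : 0 < lambda / (1 + Delta.+1%:R * lambda) ^+ 2.
  exact: (divr_gt0 lambda_gt0 (exprn_gt0 2 den0)).
rewrite vE in vge; split; [|exact: KE|].
  rewrite KE; apply: le_trans vge.
  by rewrite ler_peMr ?(ltW c0) // mulrC ler_pdivlMr // mul1r.
split=> [eqV|/disjoint_copies_complete_free_card_affine tight]; last first.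
  by rewrite KE; exact: free_card_affine_variance.
apply: (free_card_affine_disjoint_copies G_gt0).
apply: (free_card_affine_of_mean lambda_gt0 card_nbhd); apply/eqP.
(* Equality of the variances makes [vge] bound the same ratio by 1 from above. *)
rewrite eq_le mge andbT.
rewrite eqV KE (ger_pMr _ c0) mulrC (ler_pdivrMr _ _ n0) mul1r in vge.
exact: vge.
Qed.
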